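(* Let $G=(V,E)$ be a finite simple undirected weighted graph with $|V|=n$, and let $\mathcal{H}=L^2(\Omega)$ with Lebesgue measure, where $\Omega\subset\mathbb{R}^r$ ($r\geq 1$) is compact with non-empty connected interior. Let $A_G$ be a self-adjoint graph shift operator on $\mathbb{C}^n$ and $A$ a compact, self-adjoint and injective operator on $\mathcal{H}$. Let $\Phi$ be an orthonormal basis of $\mathbb{C}^n$ consisting of eigenvectors of $A_G$ and $\Xi$ an orthonormal basis of $\mathcal{H}$ consisting of eigenvectors of $A$. Suppose $\Phi'\subset\Phi$ and $\Xi'\subset\Xi$ are finite (non-empty) subsets, the span of $\Xi'$ is spanned by analytic functions, and $\mathcal{V}$ is the span of $\Phi'\otimes\Xi'=\{\phi\otimes\xi:\phi\in\Phi',\xi\in\Xi'\}$ in $S(G,\mathcal{H})$. Then: (a) Any finite $W\subset V\times\Omega$ that determines $\mathcal{V}$ has $|W|\ge|\Phi'|\cdot|\Xi'|$. (b) One can find $V'\subset V$ of size $|\Phi'|$ and a set $W\subset V\times \Omega$ with $|W|=|\Phi'|\cdot|\Xi'|$ that determines $\mathcal{V}$, with $k_v(W)=|\Xi'|$ for each $v\in V'$. For a fixed ordering $V=\{v_1,\dots,v_n\}$, a specific choice of $V'$ is given by $\{v_{i_1},\dots,v_{i_{|\Phi'|}}\}$, the vertices corresponding to $|\Phi'|$ linearly independent rows of the $n\times|\Phi'|$ matrix whose columns are the vectors of $\Phi'$. (c) One can find $W\subset V\times\Omega$ that determines $\mathcal{V}$ with $k_v(W)<|\Xi'|/\delta(\Phi')+1$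 for each $v\in V$, and $\sum_{v\in V}k_v(W)=|\Phi'|\cdot|\Xi'|$.
   Context: A graph signal in a Hilbert space $\mathcal{H}$ is a function $f:V\to\mathcal{H}$; $S(G,\mathcal{H})$ denotes the space of all such signals. It is identified with $\mathbb{C}^n\otimes\mathcal{H}$ via $f\mapsto\sum_{v\in V}v\otimes f(v)$, where $V$ is identified with the standard basis of $\mathbb{C}^n$. For $\mathcal{H}=L^2(\Omega)$, a signal is viewed as a function on $V\times\Omega$, $f(v,x)=f(v)(x)$. Elements of $\mathcal{V}$ are evaluated pointwise using their analytic representatives. A graph shift operator is a linear operator on $\mathbb{C}^n$ associated with $G$ (e.g. its adjacency or Laplacian matrix). A function $g:\Omega\to\mathbb{C}$ is analytic if it can be extended to a connected open neighborhood $U$ of $\Omega$ such that $g$ has a convergent Taylor series expansion in an open neighborhood of $x_0$, for every $x_0\in U$. A finite subset $W\subset V\times\Omega$ determines a finite dimensional subspace $\mathcal{V}\subset S(G,\mathcal{H})$ if each $f\in\mathcal{V}$ is uniquely determined (among elements of $\mathcal{V}$) by its values at the points of $W$. For $v\in V$, $k_v(W)$ is the number of points of $(\{v\}\times\Omega)\cap W$. For linearly independent vectors $\Psi=\{\psi_1,\dots,\psi_k\}$ in $\mathbb{C}^n$ ($k\le n$) and $I\subset\{1,\dots,n\}$, let $\psi_{i,I}\in\mathbb{C}^{|I|}$ be the vector of components of $\psi_i$ indexed by $I$, and $\Psi_I=\{\psi_{1,I},\dots,\psi_{k,I}\}$. Then $\delta(\Psi)$ is the largest integer $t$ such that there is a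 partition $\{1,\dots,n\}=I_1\cup\dots\cup I_t$ into disjoint subsets for which, for each $1\le j\le t$, the vectors $\psi_{1,I_j},\dots,\psi_{k,I_j}$ are linearly independent. *)

(* Defs.v *)
From HB Require Import structures.
From mathcomp Require Import all_boot all_order all_algebra.
From mathcomp Require Import generic_quotient ring_quotient finmap complex.
From mathcomp Require Import all_classical all_reals all_analysis.
From mathcomp Require Import measurable_realfun ring.

Set Implicit Arguments.
Unset Strict Implicit.
Unset Printing Implicit Defensive.

Import Order.TTheory GRing.Theory Num.Theory.
Import numFieldNormedType.Exports.

Local Open Scope classical_set_scope.
Local Open Scope ring_scope.
Local Open Scope complex_scope.
Local Open Scope quotient_scope.

Section lebesgue_outer_on.
Context {R : realType} {r : nat}.
Implicit Types A D : set 'rV[R]_r.+1.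

Definition box (ab : 'rV[R]_r.+1 * 'rV[R]_r.+1) : set 'rV[R]_r.+1 :=
  [set x | forall i, ab.1 0 i <= x 0 i <= ab.2 0 i].

(* The truncation at [0] gives an empty box volume [0]. *)
Definition box_volume (ab : 'rV[R]_r.+1 * 'rV[R]_r.+1) : R :=
  \prod_i Num.max 0 (ab.2 0 i - ab.1 0 i).

(* Lebesgue outer measure of [A `&` D]. For a Lebesgue measurable [D] (in     *)
(* particular, a compact one), its Caratheodory measurable sets are the [A]   *)
(* such that [A `&` D] is Lebesgue measurable, so it induces the Lebesgue     *)
(* measure on [D], with a null complement.                                    *)
Definition lebesgue_outer_on D A : \bar R :=
  ereal_inf [set (\sum_(k <oo) (box_volume (B k))%:E)%E |
    B in [set B : nat -> _ | A `&` D `<=` \bigcup_k box (B k)]].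

Local Open Scope ereal_scope.

Let box_volume_ge0 ab : 0 <= (box_volume ab)%:E.
Proof. by rewrite lee_fin; apply: prodr_ge0 => i _; rewrite le_max lexx. Qed.

Let lo_ge0 D A : 0 <= lebesgue_outer_on D A.
Proof. by apply: le_ereal_inf_tmp => _ [B _ <-]; exact: nneseries_ge0. Qed.

Let lo_0 D : lebesgue_outer_on D set0 = 0.
Proof.
apply/eqP; rewrite eq_le lo_ge0 andbT.
apply: ereal_inf_lbound; exists (fun=> (0%R, 0%R)); first by rewrite /= set0I.
rewrite eseries0// => k _ _; congr (_%:E).
by rewrite /box_volume big_ord_recl subrr maxxx mul0r.
Qed.

Let lo_homo D : {homo lebesgue_outer_on D : A B / A `<=` B >-> A <= B}.
Proof.
move=> A B AB; apply/ereal_inf_le_tmp => _ [C BC <-]; exists C => //.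
by apply: subset_trans BC; exact: setSI.
Qed.

Let lo_sigma_subadditive D : sigma_subadditive (lebesgue_outer_on D).
Proof.
move=> A.
have [[i ioo]|] := pselect (exists i, lebesgue_outer_on D (A i) = +oo).
  rewrite (eseries_pinfty _ _ ioo) ?leey// => n _.
  by rewrite -ltNye (lt_le_trans _ (lo_ge0 _ _)).
rewrite -forallNE => Aoo.
suff add2e (e : {posnum R}) : lebesgue_outer_on D (\bigcup_n A n) <=
    \sum_(i <oo) lebesgue_outer_on D (A i) + e%:num%:E.
  by apply/lee_addgt0Pr => _/posnumP[].
rewrite (le_trans _ (epsilon_trick _ _ _))//.
pose P n (B : nat -> 'rV[R]_r.+1 * 'rV[R]_r.+1) :=
  A n `&` D `<=` \bigcup_k box (B k) /\
  \sum_(k <oo) (box_volume (B k))%:E <=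
    lebesgue_outer_on D (A n) + (e%:num / (2 ^ n.+1)%:R)%:E.
have [G PG] : {G & forall n, P n (G n)}.
  apply: (@choice _ _ P) => n.
  have /lb_ereal_inf_adherent : lebesgue_outer_on D (A n) \is a fin_num.
    by rewrite ge0_fin_numE// ltey; apply/eqP.
  move=> /(_ (e%:num / (2 ^ n.+1)%:R)%R)[//|_ [B AB <-] xS].
  by exists B; split => //; exact/ltW.
pose v := fun p => (box_volume (uncurry G p))%:E.
have v_ge0 p : 0 <= v p by exact: box_volume_ge0.
apply: (@le_trans _ _ (\esum_(i in setT) v i)).
  apply: ereal_inf_lbound => /=.
  have /card_esym/ppcard_eqP[f] := card_nat2.
  exists (uncurry G \o f).
    move=> t [[n _ Ant] Dt]; have [k _ Gt] := (PG n).1 t (conj Ant Dt).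
    by exists (f^-1%FUN (n, k)) => //=; rewrite invK ?inE.
  rewrite -(esum_pred_image v _ xpredT) ?[fun=> _]set_true//.
  by rewrite image_eq.
rewrite (_ : esum _ _ = \sum_(i <oo) \sum_(j <oo) v (i, j)); last first.
  pose J : nat -> set (nat * nat) := fun i => [set (i, j) | j in setT].
  rewrite (_ : setT = \bigcup_k J k); last first.
    by rewrite predeqE => -[a b]; split => // _; exists a => //; exists b.
  rewrite esum_bigcupT /=; last 2 first.
    - apply/trivIsetP => i j _ _ ij.
      rewrite predeqE => -[n m] /=; split => //= -[] [_] _ [<-{n} _].
      by move=> [m' _] [] /esym/eqP; rewrite (negbTE ij).
    - by move=> p; exact: v_ge0.
  rewrite -(image_id [set: nat]) -fun_true esum_pred_image//; last first.
    by move=> n _; apply: esum_ge0 => p _; exact: v_ge0.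
  apply: eq_eseriesr => /= j _.
  rewrite -(esum_pred_image v (pair j) predT)//=; last first.
    by move=> ? ? _ _; exact: (@can_inj _ _ _ snd).
  by congr esum; rewrite predeqE => -[a b]; split; move=> [i _ <-]; exists i.
apply: lee_lim.
- by apply: is_cvg_nneseries => n *; exact: nneseries_ge0.
- apply: is_cvg_nneseries => n *; apply: adde_ge0 => //.
- by near=> n; apply: lee_sum => i _; exact: (PG i).2.
Unshelve. all: by end_near. Qed.

HB.instance Definition _ D := isOuterMeasure.Build R _ (lebesgue_outer_on D)
  (lo_0 D) (lo_ge0 D) (@lo_homo D)
  (@lo_sigma_subadditive D).

Definition lebesgue_outer_measure D :
  {outer_measure set 'rV[R]_r.+1 -> \bar R} :=
  lebesgue_outer_on D.

Definition lebesgue_on D :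
  {measure set (caratheodory_type (lebesgue_outer_measure D)) -> \bar R} :=
  lebesgue_outer_measure D.

End lebesgue_outer_on.

Section L2.
Context {d : measure_display} {T : measurableType d} {R : realType}.
Variable mu : {measure set T -> \bar R}.
Local Notation C := R[i].

Definition sqnormc (z : C) : R := complex.Re z ^+ 2 + complex.Im z ^+ 2.

Definition square_integrable (f : T -> C) : Prop :=
  [/\ measurable_fun setT (fun x => complex.Re (f x)),
      measurable_fun setT (fun x => complex.Im (f x)) &
      (\int[mu]_x (sqnormc (f x))%:E < +oo)%E].

Definition sqint : {pred T -> C} := fun f => `[< square_integrable f >].

Let ReD (x y : C) : complex.Re (x + y) = complex.Re x + complex.Re y.
Proof. by case: x y => ? ? []. Qed.

Let ImD (x y : C) : complex.Im (x + y) = complex.Im x + complex.Im y.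
Proof. by case: x y => ? ? []. Qed.

Let ReM (x y : C) :
  complex.Re (x * y) =
  complex.Re x * complex.Re y - complex.Im x * complex.Im y.
Proof. by case: x y => ? ? []. Qed.

Let ImM (x y : C) :
  complex.Im (x * y) =
  complex.Re x * complex.Im y + complex.Im x * complex.Re y.
Proof. by case: x y => ? ? []. Qed.

Let measurable_sqnormc (f : T -> C) :
  measurable_fun setT (fun x => complex.Re (f x)) ->
  measurable_fun setT (fun x => complex.Im (f x)) ->
  measurable_fun setT (EFin \o (fun x => sqnormc (f x))).
Proof.
move=> mr mi; apply/measurable_EFinP.
by apply: measurable_funD; apply: measurable_funX.
Qed.

Lemma sqint_submod_closed : submod_closed sqint.
Proof.
split.
  apply/asboolP; split; [exact: measurable_cst|exact: measurable_cst|].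
  by rewrite integral0_eq// => x _; rewrite /sqnormc /= expr0n /= addr0.
move=> a f g /asboolP[fr fi fy] /asboolP[gr gi gy]; apply/asboolP.
have mr : measurable_fun setT (fun x => complex.Re ((a *: f + g) x)).
  under eq_fun do rewrite /= ReD ReM.
  by apply: measurable_funD => //; apply: measurable_funB;
    apply: measurable_funM.
have mi : measurable_fun setT (fun x => complex.Im ((a *: f + g) x)).
  under eq_fun do rewrite /= ImD ImM.
  by apply: measurable_funD => //; apply: measurable_funD;
    apply: measurable_funM.
split => //.
pose k : R := 2 * sqnormc a.
have k0 : 0 <= k by rewrite mulr_ge0// addr_ge0// sqr_ge0.
have s0 (h : T -> C) x : (0 <= (sqnormc (h x))%:E)%E.
  by rewrite lee_fin addr_ge0// sqr_ge0.
apply: (@le_lt_trans _ _ (\int[mu]_x (k%:E * (sqnormc (f x))%:E +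
                                      2%:E * (sqnormc (g x))%:E)))%E.
  apply: ge0_le_integral => //.
  - exact: measurable_sqnormc.
  - by apply: emeasurable_funD; apply: measurable_funeM;
      exact: measurable_sqnormc.
  - move=> x _; rewrite -!EFinM -EFinD lee_fin /sqnormc /k /sqnormc.
    rewrite /= !ReD !ImD !ReM !ImM.
    case: a {mr mi k k0} (f x) (g x) => [a1 a2] [f1 f2] [g1 g2] /=.
    rewrite -subr_ge0 [leRHS](_ : _ =
      ((a1 * f1 - a2 * f2) - g1) ^+ 2 + ((a1 * f2 + a2 * f1) - g2) ^+ 2).
      by rewrite addr_ge0// sqr_ge0.
    by ring.
rewrite ge0_integralD//; last 4 first.
- by move=> x _; rewrite mule_ge0// lee_fin.
- by apply: measurable_funeM; exact: measurable_sqnormc.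
- by move=> x _; rewrite mule_ge0.
- by apply: measurable_funeM; exact: measurable_sqnormc.
rewrite !ge0_integralZl//; try exact: measurable_sqnormc.
by rewrite lte_add_pinfty// lte_mul_pinfty.
Qed.

HB.instance Definition _ := GRing.isSubmodClosed.Build _ _ sqint
  sqint_submod_closed.

Record sqint_fun := SqintFun { sqint_val :> T -> C; _ : sqint_val \in sqint }.

HB.instance Definition _ := [isSub for sqint_val].
HB.instance Definition _ := [Choice of sqint_fun by <:].
HB.instance Definition _ := [SubChoice_isSubLmodule of sqint_fun by <:].

Definition ae_null : {pred sqint_fun} :=
  fun f => `[< {ae mu, forall x, f x = 0} >].

Lemma ae_null_submod_closed : submod_closed ae_null.
Proof.
split; first by apply/asboolP; apply: aeW.
move=> a f g /asboolP f0 /asboolP g0; apply/asboolP.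
apply: filterS2 f0 g0 => x fx gx; rewrite -[LHS]/(a * f x + g x) fx gx.
by rewrite mulr0 addr0.
Qed.

HB.instance Definition _ := GRing.isSubmodClosed.Build _ _ ae_null
  ae_null_submod_closed.

Definition L2 : Type := Quotient.quot ae_null.

HB.instance Definition _ := GRing.Zmodule.on L2.
HB.instance Definition _ := EqQuotient.on L2.

Definition L2_scale (a : C) (f : L2) : L2 := \pi_L2 (a *: repr f).

Let L2_scaleE (a : C) (f : sqint_fun) :
  L2_scale a (\pi_L2 f) = \pi_L2 (a *: f).
Proof.
apply/eqP; rewrite -Quotient.idealrBE -scalerBr rpredZ//.
by rewrite Quotient.idealrBE reprK.
Qed.

Let L2_scaleA a b (f : L2) : L2_scale a (L2_scale b f) = L2_scale (a * b) f.
Proof.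
by elim/quotW: f => f; rewrite [L2_scale b _]L2_scaleE !L2_scaleE scalerA.
Qed.

Let L2_scale1 : left_id 1 L2_scale.
Proof. by elim/quotW => f; rewrite L2_scaleE scale1r. Qed.

Let L2_scaleDr : right_distributive L2_scale +%R.
Proof.
move=> a; elim/quotW => f; elim/quotW => g.
by rewrite -raddfD !L2_scaleE -raddfD scalerDr.
Qed.

Let L2_scaleDl (f : L2) : {morph L2_scale^~ f : a b / a + b}.
Proof.
by elim/quotW: f => f a b; rewrite !L2_scaleE -raddfD scalerDl.
Qed.

HB.instance Definition _ := GRing.Zmodule_isLmodule.Build C L2
  L2_scaleA L2_scale1 L2_scaleDr L2_scaleDl.

Definition L2_fun (f : L2) : T -> C := repr f.
Coercion L2_fun : L2 >-> Funclass.

Definition Cintegral (f : T -> C) : C :=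
  (\int[mu]_x complex.Re (f x))%R +i* (\int[mu]_x complex.Im (f x))%R.

Definition L2_dot (f g : L2) : C := Cintegral (fun x => f x * (g x)^*%C).

Definition L2_class_of (f : L2) (g : T -> C) : Prop :=
  {ae mu, forall x, f x = g x}.

End L2.
Arguments L2_dot {d T R mu}.

(* Linear algebra over [R[i]]; [dot : U -> U -> R[i]] is the inner product,   *)
(* linear in the first argument.                                              *)
Section inner_product.
Context {R : realType}.
Local Notation C := R[i].

Definition lspan {U : lmodType C} (S : set U) : set U :=
  [set x | exists (m : nat) (c : 'I_m -> C) (u : 'I_m -> U),
    (forall i, S (u i)) /\ x = \sum_i c i *: u i].

Context {U : lmodType C}.
Variable dot : U -> U -> C.

Definition hnorm (x : U) : R := Num.sqrt (complex.Re (dot x x)).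

Definition self_adjoint (A : U -> U) : Prop :=
  forall x y, dot (A x) y = dot x (A y).

Definition compact_operator (A : U -> U) : Prop :=
  forall u : nat -> U, (exists M, forall k, hnorm (u k) <= M) ->
  exists (s : nat -> nat) (y : U), {homo s : i j / (i < j)%N} /\
    hnorm (A (u (s k)) - y) @[k --> \oo] --> 0.

Definition is_eigenvector (A : U -> U) (x : U) : Prop :=
  x != 0 /\ exists a : C, A x = a *: x.

Definition orthonormal_basis (S : set U) : Prop :=
  (forall x y, S x -> S y -> dot x y = (x == y)%:R) /\
  (forall x (e : R), 0 < e -> exists2 y, lspan S y & hnorm (x - y) < e).

End inner_product.

Definition Cdot {R : realType} {n : nat} (x y : 'rV[R[i]]_n) : R[i] :=
  \sum_i x 0 i * (y 0 i)^*%C.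

Section analytic.
Context {R : realType} {r : nat}.
Local Notation C := R[i].
Local Notation E := 'rV[R]_r.+1.

Definition has_sum {I : choiceType} (x : I -> C) (s : C) : Prop :=
  forall e : R, 0 < e -> exists A : {fset I}, forall B : {fset I},
    (A `<=` B)%fset -> `|\sum_(i <- B) x i - s| < e%:C.

Definition monomial (y : E) (alpha : {ffun 'I_r.+1 -> nat}) : R :=
  \prod_i y 0 i ^+ alpha i.

(* The coefficients of such a power series are those of the Taylor series of  *)
(* [g] at [x0].                                                               *)
Definition taylor_expandable (g : E -> C) (x0 : E) : Prop :=
  exists c : {ffun 'I_r.+1 -> nat} -> C, \forall x \near x0,
    has_sum (fun alpha => c alpha * (monomial (x - x0) alpha)%:C) (g x).

(* Only the values of [g] on [D] matter. *)
Definition analytic_on (D : set E) (g : E -> C) : Prop :=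
  exists (U : set E) (h : E -> C),
    [/\ open U, connected U, D `<=` U,
        (forall x, D x -> h x = g x) &
        (forall x, U x -> taylor_expandable h x)].

End analytic.

Record weighted_graph (R : realType) (V : finType) := WeightedGraph {
  edge : rel V;
  weight : V -> V -> R;
  edge_sym : symmetric edge;
  edge_irr : irreflexive edge;
  weight_sym : forall u v, weight u v = weight v u
}.

(* The operator is not required to be tied to the edges in any specific way. *)
Definition graph_shift_operator {R : realType} {V : finType}
    (G : weighted_graph R V) : Type :=
  {linear 'rV[R[i]]_#|V| -> 'rV[R[i]]_#|V|}.

Section graph_signals.
Context {R : realType} {V : finType} {r : nat}.
Local Notation C := R[i].
Local Notation E := 'rV[R]_r.+1.

Definition L2_on (Omega : set E) : lmodType C :=
  L2 (lebesgue_on Omega).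

(* [rk v] is the position of the vertex [v] in the chosen ordering of [V].    *)
Definition tensor {H : lmodType C} (rk : V -> 'I_#|V|) (phi : 'rV[C]_#|V|)
  (xi : H) : V -> H := fun v => phi 0 (rk v) *: xi.

Definition analytically_spanned (Omega : set E) (S : set (L2_on Omega))
    {s : nat} (g : 'I_s -> E -> C) : Prop :=
  (forall j, analytic_on Omega (g j)) /\
  exists h : 'I_s -> L2_on Omega,
    (forall j, L2_class_of (h j) (g j)) /\ lspan (range h) = S.

(* Each [F v] is the representative of the class [f v] used for pointwise     *)
(* evaluation: a pointwise linear combination of the analytic functions [g].  *)
(* When [Omega] is not the closure of its interior, two analytic functions    *)
(* equal a.e. on [Omega] may differ at some point of [Omega], and a sum of    *)
(* functions that are [analytic_on Omega] may fail to be so, for lack of a    *)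
(* common connected neighborhood; hence the reference to [g].                 *)
Definition analytic_representative (Omega : set E) {s : nat}
    (g : 'I_s -> E -> C) (f : V -> L2_on Omega) (F : V -> E -> C) : Prop :=
  forall v, lspan (range g) (F v) /\ L2_class_of (f v) (F v).

Definition determines (Omega : set E) {s : nat} (g : 'I_s -> E -> C)
    (S : set (V -> L2_on Omega)) (W : {fset V * E}) : Prop :=
  forall f1 f2 F1 F2, S f1 -> S f2 ->
    analytic_representative g f1 F1 -> analytic_representative g f2 F2 ->
    (forall p, p \in W -> F1 p.1 p.2 = F2 p.1 p.2) -> f1 = f2.

Definition samples_in (Omega : set E) (W : {fset V * E}) : Prop :=
  forall p, p \in W -> Omega p.2.

Definition nb_samples (W : {fset V * E}) (v : V) : nat :=
  #|` [fset p in W | p.1 == v]%fset |.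

End graph_signals.

Section delta.
Context {F : fieldType} {n k : nat}.
Variable psi : 'I_k -> 'rV[F]_n.

Definition vectors_mx : 'M[F]_(k, n) := \matrix_(i < k) psi i.

Definition restricted_free (I : {set 'I_n}) : bool :=
  row_free (colsub (enum_val : 'I_#|I| -> 'I_n) vectors_mx).

(* Blocks are nonempty, which is automatic for [0 < k]. *)
Definition delta : nat :=
  \max_(P : {set {set 'I_n}} | finset.partition P [set: 'I_n]%SET &&
    [forall I in P, restricted_free I]) #|P|.

End delta.

(* Main.v *)
(* Since the [xi j] are independent in L^2 and the combinations of the        *)
(* functions [g l] that vanish a.e. vanish off a common null set, there       *)
(* are points [x_1], ..., [x_m] of [Omega], outside that null set, at which   *)
(* the representatives of the [xi j] have an invertible evaluation matrix. If *)
(* for each [j] the rows of [phi] indexed by [J_j] are [k] independent rows,  *)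
(* then the samples [(v, x_j)], [v] in [J_j], first determine the [k]         *)
(* coefficient functions of the signal at each [x_j], and then these          *)
(* functions. Taking all [J_j] equal gives (b). For (c), take an optimal      *)
(* partition in the definition of [delta] and choose [J_j] inside its block   *)
(* of index [j mod delta]; a vertex is then used at most                      *)
(* [ceil (m / delta)] times. Part (a) is a dimension count.                   *)
Require Import Defs.
From HB Require Import structures.
From mathcomp Require Import all_boot all_order all_algebra.
From mathcomp Require Import generic_quotient ring_quotient finmap complex.
From mathcomp Require Import all_classical all_reals all_analysis.
From mathcomp Require Import measurable_realfun ring lra.

Import Order.TTheory GRing.Theory Num.Theory.
Import numFieldNormedType.Exports.

Local Open Scope classical_set_scope.
Local Open Scope ring_scope.
Local Open Scope complex_scope.

Set Implicit Arguments.
Unset Strict Implicit.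

Local Open Scope quotient_scope.

(** A signal of [VV] is given by a [k] by [m] array of coefficients [a], and its value at [(v, x)]
    is bilinear: the sum of [a i j] times [phi i] at [v] times [G j x], where [G j] represents
    [xi j]. Orthonormality makes both families independent, so finite linear algebra is enough once
    pointwise values are under control.

    [sampling_points] provides that control: it finds [m] points of [Omega] at which the matrix of
    the [G j] is invertible and the value of an admissible representative depends on its class
    alone. [bilinear_coef_eq0] recovers [a] from samples at these points, provided the vertices used
    at the [j]-th point form a set [J j] on which the [phi i] stay independent;
    [determines_sampling_set] carries this over to signals.

    Only the choice of the [J j] separates (b), a constant set, from (c), sets taken in turn from
    the blocks of a partition realising [delta] and counted by [card_residue_class]. For (a), if [W]
    has fewer than [k * m] points, [exists_kernel] gives a nonzero [a] whose signal vanishes on [W],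
    so [W] cannot tell it from [0]. *)

(** * Classes in L2 and the functions representing them *)

Lemma ae_pi {d} {T : measurableType d} {R : realType}
  (mu : {measure set T -> \bar R}) (f : sqint_fun mu) :
  {ae mu, forall x, L2_fun (\pi_(L2 mu) f) x = f x}.
Proof.
have : repr (\pi_(L2 mu) f) - f \in @ae_null _ _ _ mu.
  by rewrite Quotient.idealrBE reprK.
move=> /asboolP; apply: filterS => x /= /eqP.
by rewrite subr_eq0 => /eqP.
Qed.

Lemma L2_class_of_lin {d} {T : measurableType d} {R : realType}
  (mu : {measure set T -> \bar R}) (a : R[i]) (f g : L2 mu) (F G : T -> R[i]) :
  L2_class_of f F -> L2_class_of g G -> L2_class_of (a *: f + g) (a *: F + G).
Proof.
move=> fF gG.
have -> : a *: f + g = \pi_(L2 mu) (a *: repr f + repr g).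
  by rewrite raddfD /= reprK.
apply: filterS3 fF gG (ae_pi (a *: repr f + repr g)) => x fF gG ->.
by rewrite -[LHS]/(a * L2_fun f x + L2_fun g x) [L2_fun f x]fF [L2_fun g x]gG.
Qed.

Lemma L2_class_of_inj {d} {T : measurableType d} {R : realType}
  (mu : {measure set T -> \bar R}) (f g : L2 mu) (F : T -> R[i]) :
  L2_class_of f F -> L2_class_of g F -> f = g.
Proof.
move=> fF gF; rewrite -[f]reprK -[g]reprK; apply/eqP.
rewrite -Quotient.idealrBE; apply/asboolP.
apply: filterS2 fF gF => x fF gF.
by rewrite -[LHS]/(L2_fun f x - L2_fun g x) [L2_fun f x]fF [L2_fun g x]gF subrr.
Qed.

Lemma L2_class_of0 {d} {T : measurableType d} {R : realType}
  (mu : {measure set T -> \bar R}) : L2_class_of (0 : L2 mu) 0.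
Proof.
have -> : 0 = \pi_(L2 mu) 0 by rewrite raddf0.
by apply: ae_pi.
Qed.

Lemma L2_class_of_sum {d} {T : measurableType d} {R : realType}
  (mu : {measure set T -> \bar R}) (n : nat) (a : 'I_n -> R[i])
  (f : 'I_n -> L2 mu) (F : 'I_n -> T -> R[i]) :
  (forall i, L2_class_of (f i) (F i)) ->
  L2_class_of (\sum_i a i *: f i) (\sum_i a i *: F i).
Proof.
move=> fF; elim/big_rec2: _ => [|i y1 y2 _]; first exact: L2_class_of0.
exact: L2_class_of_lin.
Qed.

Local Close Scope quotient_scope.

(** The complement of [Omega] meets [Omega] in the empty set, so it has outer measure zero, and null
    sets are Caratheodory measurable. This is what puts the sampling points inside [Omega]. *)
Lemma ae_lebesgue_on (R : realType) (r : nat) (Omega : set 'rV[R]_r.+1) :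
  {ae lebesgue_on Omega, forall x, Omega x}.
Proof.
have lo0 : lebesgue_outer_measure Omega (~` Omega) = 0%E.
  apply/eqP; rewrite eq_le outer_measure_ge0 andbT.
  rewrite -(outer_measure0 (lebesgue_outer_measure Omega)).
  apply: ereal_inf_le_tmp => _ [B _ <-]; exists B => //.
  by rewrite setICl.
exists (~` Omega); split => //.
apply: le_caratheodory_measurable => X /=.
rewrite (_ : lebesgue_outer_on _ _ = 0%E) ?add0e; last first.
  apply/eqP; rewrite eq_le outer_measure_ge0 andbT -[leRHS]lo0.
  by apply: le_outer_measure; exact: subIsetr.
by apply: le_outer_measure; exact: subIsetl.
Qed.


(** * Linearity of the L2 inner product, independence of orthonormal families *)

Definition Cintegrable {d} {T : measurableType d} {R : realType}
    (mu : {measure set T -> \bar R}) (f : T -> R[i]) : Prop :=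
  mu.-integrable setT (EFin \o (fun x => complex.Re (f x))) /\
  mu.-integrable setT (EFin \o (fun x => complex.Im (f x))).

Lemma Cintegral_lin {d} {T : measurableType d} {R : realType}
  (mu : {measure set T -> \bar R}) (a : R[i]) (f g : T -> R[i]) :
  Cintegrable mu f -> Cintegrable mu g ->
  Cintegrable mu (fun x => a * f x + g x) /\
  Cintegral mu (fun x => a * f x + g x) = a * Cintegral mu f + Cintegral mu g.
Proof.
move=> [fr fi] [gr gi]; case: a => a b.
have ZL (c : R) (h : T -> R) : mu.-integrable setT (EFin \o h) ->
    mu.-integrable setT (EFin \o (fun x => c * h x)).
  by move=> hi; apply: eq_integrable (integrableZl measurableT c hi).
have DD (h h' : T -> R) : mu.-integrable setT (EFin \o h) ->
    mu.-integrable setT (EFin \o h') ->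
    mu.-integrable setT (EFin \o (fun x => h x + h' x)).
  by move=> hi hi'; apply: eq_integrable (integrableD measurableT hi hi').
have BB (h h' : T -> R) : mu.-integrable setT (EFin \o h) ->
    mu.-integrable setT (EFin \o h') ->
    mu.-integrable setT (EFin \o (fun x => h x - h' x)).
  by move=> hi hi'; apply: eq_integrable (integrableB measurableT hi hi').
have reE x : complex.Re ((a +i* b) * f x + g x) =
    (a * complex.Re (f x) - b * complex.Im (f x)) + complex.Re (g x).
  by case: (f x) (g x) => ? ? [].
have imE x : complex.Im ((a +i* b) * f x + g x) =
    (a * complex.Im (f x) + b * complex.Re (f x)) + complex.Im (g x).
  by case: (f x) (g x) => ? ? [].
split.
  split; [under eq_fun do rewrite reE|under eq_fun do rewrite imE].
    by apply: (DD) => //; apply: (BB); exact: (ZL).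
  by apply: (DD) => //; apply: (DD); exact: (ZL).
rewrite /Cintegral; under eq_Rintegral do rewrite reE.
under [X in _ +i* X]eq_Rintegral do rewrite imE.
have zar := ZL a _ fr; have zbi := ZL b _ fi.
have zai := ZL a _ fi; have zbr := ZL b _ fr.
rewrite (RintegralD measurableT (BB _ _ zar zbi) gr).
rewrite (RintegralB measurableT zar zbi).
rewrite (RintegralD measurableT (DD _ _ zai zbr) gi).
rewrite (RintegralD measurableT zai zbr).
by rewrite !RintegralZl.
Qed.

(** Squares of sums and differences are nonnegative, which bounds the real and imaginary parts of
    the product by [sqnormc (f x) + sqnormc (g x)]. *)
Lemma Cintegrable_dot {d} {T : measurableType d} {R : realType}
  (mu : {measure set T -> \bar R}) (f g : L2 mu) :
  Cintegrable mu (fun x => f x * (g x)^*%C).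
Proof.
have sq (h : L2 mu) : [/\ measurable_fun setT (fun x => complex.Re (h x)),
      measurable_fun setT (fun x => complex.Im (h x)) &
      mu.-integrable setT (fun x => (sqnormc (h x))%:E)].
  have /asboolP[hr hi hoo] := valP (repr h).
  split => //; apply/integrableP; split.
    apply/measurable_EFinP.
    by apply: measurable_funD; apply: measurable_funX.
  by under eq_integral do rewrite abse_EFin ger0_norm ?addr_ge0 ?sqr_ge0//.
have [fr fi foo] := sq f; have [gr gi goo] := sq g.
have fgoo := integrableD measurableT foo goo.
have reE x : complex.Re (f x * (g x)^*%C) =
    complex.Re (f x) * complex.Re (g x) + complex.Im (f x) * complex.Im (g x).
  by case: (f x) (g x) => ? ? [? ?] /=; rewrite mulrN opprK.
have imE x : complex.Im (f x * (g x)^*%C) =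
    complex.Im (f x) * complex.Re (g x) - complex.Re (f x) * complex.Im (g x).
  by case: (f x) (g x) => ? ? [? ?] /=; rewrite mulrN addrC.
split.
  apply: le_integrable fgoo => //.
    apply/measurable_EFinP; under eq_fun do rewrite reE.
    by apply: measurable_funD; apply: measurable_funM.
  move=> x _; rewrite lee_fin reE /sqnormc.
  move: (complex.Re (f x)) (complex.Re (g x)) => p q.
  move: (complex.Im (f x)) (complex.Im (g x)) => u v.
  rewrite [leRHS]ger0_norm ?addr_ge0 ?sqr_ge0// ler_norml.
  have := (sqr_ge0 (p + q), sqr_ge0 (p - q)).
  have := (sqr_ge0 (u + v), sqr_ge0 (u - v)).
  by move=> [? ?] [? ?]; apply/andP; split; nra.
apply: le_integrable fgoo => //.
  apply/measurable_EFinP; under eq_fun do rewrite imE.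
  by apply: measurable_funB; apply: measurable_funM.
move=> x _; rewrite lee_fin imE /sqnormc.
move: (complex.Re (f x)) (complex.Re (g x)) => p q.
move: (complex.Im (f x)) (complex.Im (g x)) => u v.
rewrite [leRHS]ger0_norm ?addr_ge0 ?sqr_ge0// ler_norml.
have := (sqr_ge0 (u + q), sqr_ge0 (u - q)).
have := (sqr_ge0 (p + v), sqr_ge0 (p - v)).
by move=> [? ?] [? ?]; apply/andP; split; nra.
Qed.

(** [L2_dot] integrates chosen representatives, and the one chosen for [a *: f + g] agrees with the
    combination of the other two only almost everywhere. *)
Lemma L2_dot_lin {d} {T : measurableType d} {R : realType}
  (mu : {measure set T -> \bar R}) (a : R[i]) (f g h : L2 mu) :
  L2_dot (a *: f + g) h = a * L2_dot f h + L2_dot g h.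
Proof.
rewrite -(Cintegral_lin a (Cintegrable_dot f h) (Cintegrable_dot g h)).2.
have [[m1 _] [m2 _]] := conj (Cintegrable_dot (a *: f + g) h)
  (Cintegral_lin a (Cintegrable_dot f h) (Cintegrable_dot g h)).1.
have [[_ m3] [_ m4]] := conj (Cintegrable_dot (a *: f + g) h)
  (Cintegral_lin a (Cintegrable_dot f h) (Cintegrable_dot g h)).1.
have E : {ae mu, forall x, L2_fun (a *: f + g) x * (h x)^*%C =
   a * (f x * (h x)^*%C) + g x * (h x)^*%C}.
  have := @L2_class_of_lin _ _ _ mu a f g f g.
  move=> /(_ (aeW _ (fun=> erefl)) (aeW _ (fun=> erefl))).
  by apply: filterS => x ->; rewrite mulrA -mulrDl.
congr (_ +i* _); congr fine; apply: ae_eq_integral => //.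
- by case/integrableP: m1.
- by case/integrableP: m2.
- by apply: filterS E => x Ex _ /=; rewrite Ex.
- by case/integrableP: m3.
- by case/integrableP: m4.
- by apply: filterS E => x Ex _ /=; rewrite Ex.
Qed.

Lemma inner_product_free {R : realType} {U : lmodType R[i]}
  (dot : U -> U -> R[i])
  (dot_lin : forall a x y z, dot (a *: x + y) z = a * dot x z + dot y z)
  (n : nat) (x : 'I_n -> U) (x_inj : injective x)
  (x_orth : forall i j, dot (x i) (x j) = (x i == x j)%:R)
  (c : 'I_n -> R[i]) :
  \sum_i c i *: x i = 0 -> forall i, c i = 0.
Proof.
move=> c0 i.
have dot0 z : dot 0 z = 0.
  by rewrite -[0 in LHS](addr0 (0 : U)) -[X in X + _](scaler0 _ (-1)) dot_lin
    mulN1r addNr.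
have dotE z : dot (\sum_j c j *: x j) z = \sum_j c j * dot (x j) z.
  elim/big_ind2: _ => [|u b w d <- <-|j _]; first exact: dot0.
    by rewrite -[b]scale1r dot_lin mul1r scale1r.
  by rewrite -[_ *: _]addr0 dot_lin dot0 addr0.
have := dotE (x i); rewrite c0 dot0 (bigD1 i)//= x_orth eqxx mulr1.
rewrite big1 ?addr0//.
by move=> j ji; rewrite x_orth (inj_eq x_inj) (negbTE ji) mulr0.
Qed.

(** * Spans of finite families *)

(** A combination in [lspan] may repeat generators; its coefficients are gathered over each
    index. *)
Lemma lspan_rangeP {R : realType} {U : lmodType R[i]} (I : finType)
  (h : I -> U) (x : U) :
  lspan (range h) x <-> exists c : I -> R[i], x = \sum_i c i *: h i.
Proof.
split=> [[n [c [u [uh ->]]]]|[c ->]].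
  have [q qE] : {q : 'I_n -> I & forall i, u i = h (q i)}.
    apply: (@choice _ _ (fun i j => u i = h j)) => i.
    by have [j _ <-] := uh i; exists j.
  exists (fun j => \sum_(i | q i == j) c i).
  rewrite (partition_big q xpredT)//=; apply: eq_bigr => j _.
  by rewrite scaler_suml; apply: eq_bigr => i /eqP <-; rewrite qE.
exists #|I|, (fun i => c (enum_val i)), (fun i => h (enum_val i)).
split; first by move=> i; exists (enum_val i).
by rewrite (reindex _ (onW_bij _ (@enum_val_bij I))).
Qed.

Lemma lspan_rangeB {R : realType} {U : lmodType R[i]} (I : finType)
  (h : I -> U) (x y : U) :
  lspan (range h) x -> lspan (range h) y -> lspan (range h) (x - y).
Proof.
move=> /lspan_rangeP[c ->] /lspan_rangeP[c' ->].
apply/lspan_rangeP; exists (fun i => c i - c' i).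
by rewrite -sumrB; apply: eq_bigr => i _; rewrite scalerBl.
Qed.

(** * Selection of independent rows and unisolvent vertex sets *)

(** Greedy choice: while fewer than [m] rows are selected, some nonzero column is annihilated by all
    of them; by hypothesis the row of some point of [S] does not annihilate it, and this row extends
    the family. [T] may be infinite: the lemma serves both for vertices and for sampling points. *)
Lemma row_free_selection {F : fieldType} {T : Type} (m : nat) (S : set T)
  (u : T -> 'rV[F]_m) :
  (forall c : 'cV_m, (forall x, S x -> u x *m c = 0) -> c = 0) ->
  exists x : 'I_m -> T,
    [/\ injective x, forall j, S (x j) & row_free (\matrix_(j < m) u (x j))].
Proof.
move=> uS.
suff /(_ m (leqnn m))[x [xS xfree]] :
  forall p, (p <= m)%N -> exists x : 'I_p -> T,
    (forall j, S (x j)) /\ row_free (\matrix_(j < p) u (x j)).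
  exists x; split=> // a b xab; apply/eqP/negPn/negP => ab.
  have /(row_free_inj xfree)/rowP/(_ a) :
    delta_mx 0 a *m (\matrix_(j < m) u (x j)) =
    delta_mx 0 b *m (\matrix_(j < m) u (x j)) :> 'rV_m.
    by rewrite -!rowE !rowK xab.
  by rewrite !mxE !eqxx (negbTE ab) => /eqP; rewrite oner_eq0.
elim=> [_|p IHp pm].
  exists (fun i : 'I_0 => False_rect _ (notF (ltn_ord i))).
  split; first by case.
  by rewrite -row_leq_rank leq0n.
have [x [xS xfree]] := IHp (ltnW pm).
set M := \matrix_(j < p) u (x j) in xfree.
have : cokermx M != 0.
  by rewrite -mxrank_eq0 mxrank_coker (eqP xfree) subn_eq0 -ltnNge.
move=> /eqP/matrixP coM.
have [j cj0] : exists j, col j (cokermx M) != 0.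
  apply: contra_notP coM => /forallNP coM i j.
  have /negP := coM j; rewrite negbK => /eqP/colP/(_ i).
  by rewrite !mxE.
have [x0 Sx0 ux0] : exists2 x0, S x0 & u x0 *m col j (cokermx M) != 0.
  apply: contraPP cj0 => nx; apply/negP; rewrite negbK; apply/eqP/uS => y Sy.
  by apply/eqP/negPn/negP => uy; apply: nx; exists y.
exists (fun i : 'I_(1 + p) =>
  match fintype.split i with inl _ => x0 | inr i' => x i' end); split.
  by move=> i; case: fintype.splitP.
rewrite (_ : matrix_of_fun _ _ = (col_mx (u x0) M : 'M[F]_(1 + p, m)));
    last first.
  apply/row_matrixP => i; rewrite rowK.
  by apply/rowP => l; rewrite mxE [in RHS]mxE; case: fintype.splitP => i' _;
    rewrite ?mxE// (ord1 i').
apply: (@inj_row_free _ (1 + p)) => v; rewrite -[v]hsubmxK mul_row_col => v0.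
(* Multiplying by the chosen column kills the rows of [M] and leaves the coefficient of the new row
   times a nonzero scalar. *)
have vl0 : lsubmx (v : 'rV_(1 + p)) = 0.
  have := congr1 (fun w => w *m col j (cokermx M)) v0.
  rewrite /= mul0mx mulmxDl -!mulmxA [col j _ in X in _ + X]colE.
  rewrite [M *m _]mulmxA mulmx_coker mul0mx mulmx0.
  rewrite addr0 [u x0 *m _]mx11_scalar mul_mx_scalar => /eqP.
  rewrite scaler_eq0 => /orP[/eqP u0|/eqP//].
  by case/eqP: ux0; rewrite [LHS]mx11_scalar u0 raddf0.
have vr0 : rsubmx (v : 'rV_(1 + p)) = 0.
  by apply: (row_free_inj xfree); rewrite mul0mx -v0 vl0 mul0mx add0r.
by rewrite vl0 vr0 row_mx0.
Qed.

(** The independence expressed by [restricted_free], put in terms of coefficients to avoid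
    enumerating [I]; the name comes from interpolation theory. *)
Definition unisolvent {F : fieldType} {n k : nat} (phi : 'I_k -> 'rV[F]_n)
    (I : {set 'I_n}) : Prop :=
  forall c : 'I_k -> F, (forall i, i \in I -> \sum_l c l * phi l 0 i = 0) ->
  forall l, c l = 0.

Lemma unisolvent_subset {F : fieldType} {n k : nat} (phi : 'I_k -> 'rV[F]_n)
  (I : {set 'I_n}) : unisolvent phi I ->
  exists J : {set 'I_n}, [/\ J \subset I, #|J| = k & unisolvent phi J].
Proof.
move=> uI.
have [|x [x_inj xI xfree]] :=
  @row_free_selection F 'I_n k [set i | i \in I]%classic
    (fun i => \row_l phi l 0 i).
  move=> c c0; apply/colP => l; rewrite mxE.
  apply: (uI (fun l => c l 0)) => i iI.
  have /matrixP/(_ 0 0) := c0 i iI; rewrite !mxE => ci; rewrite -[RHS]ci.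
  by apply: eq_bigr => l' _; rewrite mxE mulrC.
exists (x @: [set: 'I_k])%SET; split.
- by apply/fintype.subsetP => _ /imsetP[j _ ->]; exact: xI.
- by rewrite card_imset// cardsT card_ord.
move=> c c0 l.
move: xfree; set M := matrix_of_fun _ _; rewrite row_free_unit => uM.
have : M *m \col_l c l = 0.
  apply/colP => j; rewrite !mxE -[RHS](c0 (x j)) ?imset_f//.
  by apply: eq_bigr => l' _; rewrite !mxE mulrC.
move=> /(congr1 (mulmx (invmx M))).
by rewrite mulKmx// mulmx0 => /colP/(_ l); rewrite !mxE.
Qed.

Lemma unisolvent_restricted_free {F : fieldType} {n k : nat}
  (phi : 'I_k -> 'rV[F]_n) (I : {set 'I_n}) :
  restricted_free phi I -> unisolvent phi I.
Proof.
move=> fI c c0 l.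
have /rowP/(_ l) : \row_l c l = 0.
  apply: (row_free_inj fI); rewrite mul0mx; apply/rowP => i.
  rewrite !mxE -[RHS](c0 (enum_val i) (enum_valP i)).
  by apply: eq_bigr => l' _; rewrite !mxE.
by rewrite !mxE.
Qed.

(** With [#|I| = k] the submatrix is square, so independence of its rows is independence of its
    columns. *)
Lemma unisolvent_rowsub {F : fieldType} {n k : nat}
  (phi : 'I_k -> 'rV[F]_n) (I : {set 'I_n}) : #|I| = k ->
  row_free (rowsub (enum_val : 'I_#|I| -> 'I_n) (vectors_mx phi)^T) ->
  unisolvent phi I.
Proof.
move=> Ik /eqP fI; apply: unisolvent_restricted_free.
rewrite /restricted_free /row_free -mxrank_tr -[X in _ == X]Ik -[X in _ == X]fI.
by apply/eqP; congr mxrank; apply/matrixP => i j; rewrite !mxE.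
Qed.

(** For fixed [j], unisolvence of [J j] removes the sum over [i]: the image under [M] of each [a i]
    vanishes in component [j]. Invertibility of [M] then removes the other sum. [J] may depend on
    [j] because the first move is made for each [j] separately. *)
Lemma bilinear_coef_eq0 {F : fieldType} {n k m : nat} (phi : 'I_k -> 'rV[F]_n)
  (M : 'M[F]_m) (J : 'I_m -> {set 'I_n}) (a : 'I_k -> 'I_m -> F) :
  row_free M -> (forall j, unisolvent phi (J j)) ->
  (forall j v, v \in J j ->
    \sum_l (\sum_i a i l * phi i 0 v) * M j l = 0) ->
  forall i j, a i j = 0.
Proof.
rewrite row_free_unit => uM uJ a0 i j.
have : M *m \col_l a i l = 0.
  apply/colP => j'; rewrite !mxE.
  apply: (uJ j' (fun i => \sum_l M j' l * (\col_l a i l) l 0)) => v vJ.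
  rewrite -[RHS](a0 j' v vJ).
  under eq_bigr do rewrite mulr_suml.
  rewrite exchange_big; apply: eq_bigr => l _; rewrite mulr_suml.
  by apply: eq_bigr => i' _; rewrite mxE [RHS]mulrC mulrA.
move=> /(congr1 (mulmx (invmx M))).
by rewrite mulKmx// mulmx0 => /colP/(_ j); rewrite !mxE.
Qed.

(** * Points where evaluation is invertible *)

(** A column annihilated by the evaluation vectors at all points of a conull subset [Z] of [D] gives
    a combination of the [xi j] that vanishes almost everywhere, so it is zero and
    [row_free_selection] applies in [Z]. The equality of spans serves in both directions: it
    produces the [G j] from the [g l] and writes each [h l] through the [xi j]. *)
Lemma sampling_points {R : realType} {d} {T : measurableType d}
  (mu : {measure set T -> \bar R}) (D : set T) (m s : nat)
  (xi : 'I_m -> L2 mu) (h : 'I_s -> L2 mu) (g : 'I_s -> T -> R[i]) :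
  {ae mu, forall x, D x} ->
  (forall c : 'I_m -> R[i], \sum_j c j *: xi j = 0 -> forall j, c j = 0) ->
  (forall l, L2_class_of (h l) (g l)) -> lspan (range h) = lspan (range xi) ->
  exists (G : 'I_m -> T -> R[i]) (x : 'I_m -> T),
    [/\ forall j, lspan (range g) (G j) /\ L2_class_of (xi j) (G j),
        injective x /\ forall i, D (x i),
        row_free (\matrix_(i, j) G j (x i)) &
        forall F a, lspan (range g) F -> L2_class_of (\sum_j a j *: xi j) F ->
          forall i, F (x i) = \sum_j a j * G j (x i)].
Proof.
move=> aeD xi_free hg hxi.
have spanE (U : lmodType R[i]) n (u : 'I_n -> U) i : lspan (range u) (u i).
  apply/lspan_rangeP; exists (fun j => (j == i)%:R).
  rewrite (bigD1 i)//= eqxx scale1r big1 ?addr0// => j /negbTE ->.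
  by rewrite scale0r.
have [c cE] : {c : 'I_m -> 'I_s -> R[i] & forall j, xi j = \sum_l c j l *: h l}.
  apply: (@choice _ _ (fun j (c : 'I_s -> R[i]) => xi j = \sum_l c l *: h l)).
  by move=> j; apply/lspan_rangeP; rewrite hxi.
have [b bE] : {b : 'I_s -> 'I_m -> R[i] & forall l, h l = \sum_j b l j *: xi j}.
  apply: (@choice _ _ (fun l (b : 'I_m -> R[i]) => h l = \sum_j b j *: xi j)).
  by move=> l; apply/lspan_rangeP; rewrite -hxi.
pose G j := \sum_l c j l *: g l.
have Gxi j : L2_class_of (xi j) (G j) by rewrite cE; exact: L2_class_of_sum.
have Gspan j : lspan (range g) (G j) by apply/lspan_rangeP; exists (c j).
(* A combination of the [g l] is a combination of the [G j] plus one of the   *)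
(* functions [g l - \sum_j b l j *: G j], which all vanish on [Z]; so on [Z]  *)
(* the values of a representative depend only on its class.                   *)
pose Z := [set x | D x /\ forall l, g l x = \sum_j b l j * G j x]%classic.
have aeZ : {ae mu, forall x, Z x}.
  apply: filterS2 aeD (_ : {ae mu, forall x, forall l,
    g l x = \sum_j b l j * G j x}) => //.
  (* There are finitely many [l], so the exceptional null sets are united one index at a time. *)
  have : \forall x \near almost_everywhere mu, forall l, l \in enum 'I_s ->
      g l x = \sum_j b l j * G j x.
    elim: (enum _) => [|l e IH]; first exact: aeW.
    have := @L2_class_of_sum _ _ _ mu _ (b l) xi G Gxi; rewrite -bE => hl.
    apply: filterS3 IH hl (hg l) => x IH hl hl' l'.
    rewrite inE => /orP[/eqP ->|]; last exact: IH.
    by rewrite -[LHS]hl' [LHS]hl fct_sumE.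
  by apply: filterS => x gx l; apply: gx; rewrite mem_enum.
have FE F a : lspan (range g) F -> L2_class_of (\sum_j a j *: xi j) F ->
    forall x, Z x -> F x = \sum_j a j * G j x.
  move=> /lspan_rangeP[e ->] aF x [_ Zx].
  (* The coefficients of [F] on the [g l], pushed through [b], must be [a] since the [xi j] are
     independent. *)
  have : \sum_j (\sum_l e l * b l j - a j) *: xi j = 0.
    have aE := L2_class_of_inj aF (@L2_class_of_sum _ _ _ mu _ e h g hg).
    under eq_bigr do rewrite scalerBl scaler_suml.
    rewrite sumrB aE; apply/eqP; rewrite subr_eq0; apply/eqP.
    rewrite exchange_big; apply: eq_bigr => l _; rewrite bE scaler_sumr.
    by apply: eq_bigr => j _; rewrite scalerA.
  move=> /xi_free aE; rewrite fct_sumE.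
  transitivity (\sum_l e l * (\sum_j b l j * G j x)).
    by apply: eq_bigr => l _; rewrite -Zx.
  under eq_bigr do rewrite mulr_sumr.
  rewrite exchange_big; apply: eq_bigr => j _.
  have /eqP := aE j; rewrite subr_eq0 => /eqP <-; rewrite mulr_suml.
  by apply: eq_bigr => l _; rewrite mulrA.
have [|x [x_inj Zx xfree]] :=
  @row_free_selection _ T m Z (fun x => \row_j G j x).
  move=> a a0; apply/colP => j; rewrite mxE.
  apply: (xi_free (fun j => a j 0)).
  apply: (@L2_class_of_inj _ _ _ mu _ _ (\sum_j a j 0 *: G j)).
    exact: L2_class_of_sum.
  apply: filterS2 aeZ (L2_class_of0 mu) => x Zx ->.
  have /matrixP/(_ 0 0) := a0 x Zx; rewrite !mxE => ax.
  rewrite -[LHS]ax fct_sumE.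
  by apply: eq_bigr => l _; rewrite mxE mulrC.
exists G, x; split=> //.
- by split=> // i; case: (Zx i).
- rewrite (_ : matrix_of_fun _ _ = \matrix_(j < m) \row_l G l (x j))//.
  by apply/matrixP => i j; rewrite !mxE.
- by move=> F a Fg Fa i; exact: FE.
Qed.

(** * Sampling sets and their cardinalities *)

Definition sampling_set {V : finType} {E : choiceType} {m : nat} (x : 'I_m -> E)
    (J : 'I_m -> {set V}) : {fset V * E} :=
  seq_fset tt [seq (p.1, x p.2) |
    p : V * 'I_m <- enum [pred p : V * 'I_m | p.1 \in J p.2]].

Lemma in_sampling_set {V : finType} {E : choiceType} {m : nat} (x : 'I_m -> E)
  (J : 'I_m -> {set V}) (p : V * E) :
  reflect (exists2 j, p.1 \in J j & p.2 = x j) (p \in sampling_set x J).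
Proof.
rewrite seq_fsetE; apply: (iffP mapP) => [[[v j]]|[j vj xj]].
  by rewrite mem_enum inE /= => vj ->; exists j.
exists (p.1, j); first by rewrite mem_enum inE.
by case: p vj xj => v y /= _ ->.
Qed.

Lemma card_sampling_set {V : finType} {E : choiceType} {m : nat} (x : 'I_m -> E)
  (J : 'I_m -> {set V}) : injective x ->
  #|` sampling_set x J| = (\sum_j #|J j|)%N.
Proof.
move=> x_inj; rewrite size_seq_fset undup_id; last first.
  rewrite map_inj_uniq ?enum_uniq// => -[v j] [w l] /= [-> /x_inj ->] //.
rewrite size_map -cardE -sum1_card.
under [RHS]eq_bigr do rewrite -sum1_card.
rewrite (exchange_big_dep xpredT)//= pair_big_dep /=.
by apply: eq_bigl => p; rewrite inE.
Qed.

(** The samples above [v] form the sampling set of the sets [J j] cut down to [v], so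
    [card_sampling_set] counts them too. *)
Lemma nb_samples_sampling_set {R : realType} {V : finType} {r m : nat}
  (x : 'I_m -> 'rV[R]_r.+1) (J : 'I_m -> {set V}) (v : V) : injective x ->
  nb_samples (sampling_set x J) v = #|[set j | v \in J j]%SET|.
Proof.
move=> x_inj.
rewrite /nb_samples (_ : [fset p in _ | _]%fset =
    sampling_set x (fun j => J j :&: [set v])%SET); last first.
  apply/fsetP => p; rewrite !inE /=.
  apply/andP/in_sampling_set => [[/in_sampling_set[j pj pE] /eqP pv]|[j]].
    by exists j; rewrite // !inE pj pv eqxx.
  rewrite !inE => /andP[pj pv] pE; split=> //.
  by apply/in_sampling_set; exists j.
rewrite card_sampling_set// -sum1_card [RHS]big_mkcond /=.
apply: eq_bigr => j _; rewrite inE; case: ifPn => vj.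
  by rewrite (finset.setIidPr _) ?cards1// finset.sub1set.
apply/eqP; rewrite finset.cards_eq0; apply/eqP/finset.setP => w; rewrite !inE.
by apply/negP => /andP[wj /eqP wv]; rewrite wv (negbTE vj) in wj.
Qed.

Lemma sum_nb_samples_sampling_set {R : realType} {V : finType} {r m : nat}
  (x : 'I_m -> 'rV[R]_r.+1) (J : 'I_m -> {set V}) : injective x ->
  (\sum_v nb_samples (sampling_set x J) v = \sum_j #|J j|)%N.
Proof.
move=> x_inj.
under eq_bigr do rewrite nb_samples_sampling_set// -sum1_card big_mkcond.
rewrite exchange_big /=; apply: eq_bigr => j _.
by rewrite -sum1_card [RHS]big_mkcond; apply: eq_bigr => v _; rewrite inE.
Qed.

(** * Residue classes, optimal partitions, dimension count *)

(** Elements of one residue class are told apart by their quotients by [t], which are at most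
    [m.-1 %/ t]. Multiplying by [t] states the strict bound of (c) without division. *)
Lemma card_residue_class (m t i : nat) : (0 < m)%N -> (0 < t)%N ->
  (t * #|[set j : 'I_m | (j %% t)%N == i]%SET| < m + t)%N.
Proof.
move=> m0 t0; set S := [set j | _]%SET.
have le_div (j : 'I_m) : (j %/ t < (m.-1 %/ t).+1)%N.
  by rewrite ltnS leq_div2r// -ltnS prednK.
suff Sle : (#|S| <= (m.-1 %/ t).+1)%N.
  rewrite (@leq_ltn_trans (t * (m.-1 %/ t).+1))%N ?leq_mul2l ?Sle ?orbT//.
  rewrite mulnS addnC ltn_add2r mulnC (leq_ltn_trans (leq_trunc_div _ _))//.
  by rewrite prednK.
pose q (j : 'I_m) := Ordinal (le_div j).
rewrite -[leqRHS]card_ord -(@card_in_imset _ _ q) ?max_card//.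
move=> a b; rewrite !inE => /eqP at_ /eqP bt [] /= ab.
by apply/val_inj => /=; rewrite (divn_eq a t) (divn_eq b t) at_ bt ab.
Qed.

(** The one-block partition is admissible, its block being nonempty as [0 < n]. So the maximum
    defining [delta] is attained, instead of being the default [0], and is at least [1]. *)
Lemma delta_partition {F : fieldType} {n k : nat} (psi : 'I_k -> 'rV[F]_n) :
  (0 < n)%N -> restricted_free psi [set: 'I_n]%SET ->
  exists P : {set {set 'I_n}}, [/\ finset.partition P [set: 'I_n]%SET,
    forall I, I \in P -> restricted_free psi I & #|P| = delta psi] /\
    (0 < delta psi)%N.
Proof.
move=> n0 fT.
pose A (P : {set {set 'I_n}}) := finset.partition P [set: 'I_n]%SET &&
    [forall I in P, restricted_free psi I].
have AT : A [set [set: 'I_n]]%SET.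
  apply/andP; split.
    apply/and3P; split.
    - by rewrite /finset.cover finset.big_set1.
    - apply/finset.trivIsetP => B C; rewrite !inE => /eqP-> /eqP->.
      by rewrite eqxx.
    - by rewrite inE eq_sym -card_gt0 cardsT card_ord.
  by apply/forall_inP => I; rewrite inE => /eqP ->.
have [P /andP[PT /forall_inP Pf] PE] : {P | A P & delta psi = #|P|}.
  rewrite /delta (@bigop.bigmax_eq_arg _ _ A _ AT); case: arg_maxnP => // P AP _.
  by exists P.
exists P; split; first by split.
rewrite -[1%N](@cards1 _ [set: 'I_n]%SET).
exact: (@bigop.leq_bigmax_cond _ A _ _ AT).
Qed.

Lemma exists_kernel {F : fieldType} (I J : finType) (u : I -> J -> F) :
  (#|J| < #|I|)%N ->
  exists2 c : I -> F, exists i, c i != 0 & forall j, \sum_i c i * u i j = 0.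
Proof.
move=> JI; pose M := \matrix_(i < #|I|, j < #|J|) u (enum_val i) (enum_val j).
have : kermx M != 0.
  rewrite -mxrank_eq0 mxrank_ker subn_eq0 -ltnNge.
  by rewrite (leq_ltn_trans (rank_leq_col _)).
case/rowV0Pn => v /sub_kermxP vM v0; exists (fun i => v 0 (enum_rank i)).
  apply: contra_neqP v0 => /forallNP v0; apply/rowP => i; rewrite mxE.
  by have /negP := v0 (enum_val i); rewrite negbK enum_valK => /eqP.
move=> j; have /rowP/(_ (enum_rank j)) := vM; rewrite !mxE => vMj.
rewrite -[RHS]vMj (reindex _ (onW_bij _ (@enum_val_bij I))).
by apply: eq_bigr => i _; rewrite mxE enum_valK enum_rankK.
Qed.

Lemma lspan_range_sum {R : realType} {U : lmodType R[i]} (I J : finType)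
  (h : I -> U) (u : J -> U) (c : J -> R[i]) :
  (forall j, lspan (range h) (u j)) -> lspan (range h) (\sum_j c j *: u j).
Proof.
move=> uh.
have [b bE] : {b : J -> I -> R[i] & forall j, u j = \sum_i b j i *: h i}.
  apply: (@choice _ _ (fun j (b : I -> R[i]) => u j = \sum_i b i *: h i)) => j.
  exact/lspan_rangeP.
apply/lspan_rangeP; exists (fun i => \sum_j c j * b j i).
under eq_bigr do rewrite bE scaler_sumr.
rewrite exchange_big; apply: eq_bigr => i _; rewrite scaler_suml.
by apply: eq_bigr => j _; rewrite scalerA.
Qed.

Lemma Cdot_lin {R : realType} {n : nat} (a : R[i]) (x y z : 'rV[R[i]]_n) :
  Cdot (a *: x + y) z = a * Cdot x z + Cdot y z.
Proof.
rewrite /Cdot mulr_sumr -big_split; apply: eq_bigr => i _ /=.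
by rewrite !mxE mulrDl mulrA.
Qed.

(** * Signals as combinations of tensors *)

(** Grouping by [j] exhibits the signal at a vertex as a combination of the [xi j], the form to
    which [sampling_points] and the independence of the [xi j] apply. *)
Lemma tensor_sumE {R : realType} {V : finType} {H : lmodType R[i]} {k m : nat}
  (rk : V -> 'I_#|V|) (phi : 'I_k -> 'rV[R[i]]_#|V|) (xi : 'I_m -> H)
  (a : 'I_k * 'I_m -> R[i]) (v : V) :
  (\sum_p a p *: tensor rk (phi p.1) (xi p.2)) v =
  \sum_j (\sum_i a (i, j) * phi i 0 (rk v)) *: xi j.
Proof.
rewrite fct_sumE.
transitivity (\sum_i \sum_j (a (i, j) *: tensor rk (phi i) (xi j)) v).
  by rewrite pair_bigA; apply: eq_bigr => -[i j].
rewrite exchange_big; apply: eq_bigr => j _; rewrite scaler_suml.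
by apply: eq_bigr => i _; rewrite -scalerA.
Qed.

Lemma tensor_span_range {R : realType} {V : finType} {H : lmodType R[i]}
  {k m : nat} (rk : V -> 'I_#|V|) (phi : 'I_k -> 'rV[R[i]]_#|V|)
  (xi : 'I_m -> H) :
  [set f | exists i j, f = tensor rk (phi i) (xi j)]%classic =
  range (fun p : 'I_k * 'I_m => tensor rk (phi p.1) (xi p.2)).
Proof.
apply/seteqP; split => [_ [i [j ->]]|_ [p _ <-]]; first by exists (i, j).
by exists p.1, p.2.
Qed.

(** By linearity the difference of two signals is treated: [F1 v - F2 v] represents its class at [v]
    and lies in the span of the [g l], so its samples are expressed by the [G j], and
    [bilinear_coef_eq0] makes all coefficients vanish. The [J j] are sets of positions, hence the
    preimage by [rk]. *)
Lemma determines_sampling_set {R : realType} {V : finType} {r : nat}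
  (Omega : set 'rV[R]_r.+1) (k m s : nat) (rk : V -> 'I_#|V|)
  (phi : 'I_k -> 'rV[R[i]]_#|V|) (xi : 'I_m -> L2_on Omega)
  (g : 'I_s -> 'rV[R]_r.+1 -> R[i]) (G : 'I_m -> 'rV[R]_r.+1 -> R[i])
  (x : 'I_m -> 'rV[R]_r.+1) (J : 'I_m -> {set 'I_#|V|}) :
  bijective rk ->
  row_free (\matrix_(i, j) G j (x i)) ->
  (forall (F : 'rV[R]_r.+1 -> R[i]) a, lspan (range g) F ->
    L2_class_of (\sum_j a j *: xi j) F ->
    forall i, F (x i) = \sum_j a j * G j (x i)) ->
  (forall j, unisolvent phi (J j)) ->
  determines g
    (lspan [set f | exists i j, f = tensor rk (phi i) (xi j)]%classic)
    (sampling_set x (fun j => rk @^-1: J j)%SET).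
Proof.
move=> [rk' rkK rk'K] Gfree FE uJ f1 f2 F1 F2; rewrite tensor_span_range.
move=> f1V f2V f1F f2F F12; apply/eqP; rewrite -subr_eq0; apply/eqP.
have /lspan_rangeP[a fE] := lspan_rangeB f1V f2V.
rewrite fE big1// => -[i j] _.
suff a0 : forall i j, a (i, j) = 0 by rewrite a0 scale0r.
apply: (bilinear_coef_eq0 (phi := phi) Gfree uJ) => {i j} j w wJ.
have <- := rk'K w; set v := rk' w.
transitivity ((F1 v - F2 v) (x j)); last first.
  apply/eqP; rewrite subr_eq0; apply/eqP/(F12 (v, x j)).
  by apply/in_sampling_set; exists j; rewrite // inE /= rk'K.
rewrite (FE (F1 v - F2 v) (fun j => \sum_i a (i, j) * phi i 0 (rk v))).
- by apply: eq_bigr => l _; rewrite mxE.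
- by apply: lspan_rangeB; [exact: (f1F v).1|exact: (f2F v).1].
rewrite -tensor_sumE -fE.
rewrite -[f1 - f2]addrC -scaleN1r -[F1 v - F2 v]addrC -[- F2 v]scaleN1r.
by apply: L2_class_of_lin; [exact: (f2F v).2|exact: (f1F v).2].
Qed.

Theorem proposition3 (R : realType)
  (V : finType) (G : weighted_graph R V)
  (r : nat) (Omega : set 'rV[R]_r.+1)
  (Omega_compact : compact Omega)
  (Omega_int_neq0 : (Omega° !=set0)%classic)
  (Omega_int_connected : connected (Omega°)%classic)
  (AG : graph_shift_operator G) (AG_sa : self_adjoint Cdot AG)
  (A : {linear L2_on Omega -> L2_on Omega})
  (A_compact : compact_operator L2_dot A)
  (A_sa : self_adjoint L2_dot A) (A_inj : injective A)
  (Phi : set 'rV[R[i]]_#|V|) (Phi_onb : orthonormal_basis Cdot Phi)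
  (Phi_eig : forall x, Phi x -> is_eigenvector AG x)
  (Xi : set (L2_on Omega)) (Xi_onb : orthonormal_basis L2_dot Xi)
  (Xi_eig : forall x, Xi x -> is_eigenvector A x)
  (k : nat) (phi : 'I_k -> 'rV[R[i]]_#|V|) (k_gt0 : (0 < k)%N)
  (phi_inj : injective phi) (phi_Phi : forall i, Phi (phi i))
  (m : nat) (xi : 'I_m -> L2_on Omega) (m_gt0 : (0 < m)%N)
  (xi_inj : injective xi) (xi_Xi : forall j, Xi (xi j))
  (s : nat) (g : 'I_s -> 'rV[R]_r.+1 -> R[i])
  (xi_analytic : analytically_spanned (lspan (range xi)) g)
  (rk : V -> 'I_#|V|) (rk_bij : bijective rk) :
  let VV : set (V -> L2_on Omega) :=
    lspan [set f | exists i j, f = tensor rk (phi i) (xi j)] in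
  let vertices_ok (V' : {set V}) : Prop :=
    #|V'| = k /\
    exists W : {fset V * 'rV[R]_r.+1},
      [/\ samples_in Omega W, #|` W| = (k * m)%N, determines g VV W &
          forall v, v \in V' -> nb_samples W v = m] in
  (forall W : {fset V * 'rV[R]_r.+1},
     samples_in Omega W -> determines g VV W -> (k * m <= #|` W|)%N) /\
  ((exists V' : {set V}, vertices_ok V') /\
   (forall I : {set 'I_#|V|}, #|I| = k ->
      row_free (rowsub (enum_val : 'I_#|I| -> 'I_#|V|) (vectors_mx phi)^T) ->
      vertices_ok (rk @^-1: I)%SET)) /\
  (exists W : {fset V * 'rV[R]_r.+1},
     [/\ samples_in Omega W, determines g VV W,
         (forall v, (nb_samples W v)%:R < m%:R / (delta phi)%:R + 1 :> rat) &
         (\sum_v nb_samples W v = k * m)%N]).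
Proof.
rewrite /=.
have xi_free := inner_product_free (@L2_dot_lin _ _ _ _) xi_inj
  (fun i j => Xi_onb.1 _ _ (xi_Xi i) (xi_Xi j)).
have phi_free := inner_product_free (@Cdot_lin _ _) phi_inj
  (fun i j => Phi_onb.1 _ _ (phi_Phi i) (phi_Phi j)).
have [_ [h [hg hxi]]] := xi_analytic.
have [G0 [x [Gxi [x_inj xO] Gfree FE]]] :=
  sampling_points (ae_lebesgue_on Omega) xi_free hg hxi.
(* [sampling_points] types its result by the measurable carrier of [lebesgue_on]; sampling sets are
   built from plain row vectors. *)
change ('I_m -> 'rV[R]_r.+1 -> R[i]) in (type of G0).
change ('I_m -> 'rV[R]_r.+1) in (type of x).
have uT : unisolvent phi [set: 'I_#|V|]%SET.
  move=> c c0; apply: phi_free; apply/rowP => i; rewrite summxE mxE.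
  rewrite -[RHS](c0 i) ?inE//.
  by apply: eq_bigr => l _; rewrite mxE.
have card_rk (I : {set 'I_#|V|}) : #|(rk @^-1: I)%SET| = #|I|.
  by apply: on_card_preimset; apply: onW_bij.
(* The same vertices serve at every point, so each of them is sampled [m] times. *)
have part_b (I : {set 'I_#|V|}) : #|I| = k -> unisolvent phi I ->
    #|(rk @^-1: I)%SET| = k /\
    exists W : {fset V * 'rV[R]_r.+1},
      [/\ samples_in Omega W, #|` W| = (k * m)%N,
          determines g
            (lspan [set f | exists i j, f = tensor rk (phi i) (xi j)]%classic) W &
          forall v, v \in (rk @^-1: I)%SET -> nb_samples W v = m].
  move=> Ik uI; split; first by rewrite card_rk.
  exists (sampling_set x (fun=> rk @^-1: I)%SET); split.
  - by move=> p /in_sampling_set[j _ ->]; exact: xO.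
  - by rewrite card_sampling_set// sum_nat_const card_ord card_rk Ik mulnC.
  - exact: (determines_sampling_set rk_bij Gfree FE (fun=> uI)).
  - move=> v vI; rewrite nb_samples_sampling_set//.
    transitivity #|[set: 'I_m]%SET|; last by rewrite cardsT card_ord.
    by apply: eq_card => j; rewrite !inE -[RHS]vI inE.
split.
  move=> W WO Wdet; rewrite leqNgt; apply/negP => Wlt.
  (* One equation per sample, against [k * m] unknown coefficients. *)
  have [|c [p0 cp0] c0] := @exists_kernel _ ('I_k * 'I_m)%type W
      (fun p w => phi p.1 0 (rk (val w).1) * G0 p.2 (val w).2).
    by rewrite card_prod !card_ord -cardfE.
  case/eqP: cp0; case: p0 => i0 j0.
  pose f := \sum_p c p *: tensor rk (phi p.1) (xi p.2).
  (* [F] represents [f] through the [G0 j]; it vanishes on [W], as does the representative [0] of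
     the zero signal. *)
  pose F v := \sum_j (\sum_i c (i, j) * phi i 0 (rk v)) *: G0 j.
  have f0 : f = 0.
    apply: (Wdet f 0 F 0).
    - by rewrite tensor_span_range; apply/lspan_rangeP; exists c.
    - rewrite tensor_span_range; apply/lspan_rangeP; exists (fun=> 0).
      by rewrite big1// => p _; rewrite scale0r.
    - move=> v; split; last first.
        by rewrite /f tensor_sumE; apply: L2_class_of_sum => j; exact: (Gxi j).2.
      by apply: lspan_range_sum => j; exact: (Gxi j).1.
    - move=> v; split; last exact: L2_class_of0.
      apply/lspan_rangeP; exists (fun=> 0).
      by rewrite big1// => p _; rewrite scale0r.
    move=> w wW; have := c0 [` wW]%fset => /= cw.
    rewrite -[RHS]cw /F fct_sumE.
    transitivity (\sum_i \sum_j c (i, j) * (phi i 0 (rk w.1) * G0 j w.2));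
      last first.
      by rewrite pair_bigA; apply: eq_bigr => -[i j].
    rewrite exchange_big; apply: eq_bigr => j _.
    rewrite -[LHS]/(_ * _) mulr_suml; apply: eq_bigr => i _.
    by rewrite mulrA.
  (* The tensors are independent: [f = 0] kills the coefficient of each [xi j] at each vertex, and
     then the [phi i] are independent over all vertices. *)
  apply: (uT (fun i => c (i, j0))) => w _.
  have [rk' rkK rk'K] := rk_bij; rewrite -(rk'K w).
  apply: (xi_free (fun j => \sum_i c (i, j) * phi i 0 (rk (rk' w)))).
  by rewrite -tensor_sumE -/f f0.
split.
  split.
    have [I [_ Ik uI]] := unisolvent_subset uT.
    by exists (rk @^-1: I)%SET; exact: part_b.
  by move=> I Ik If; apply: part_b => //; exact: unisolvent_rowsub If.
have fT : restricted_free phi [set: 'I_#|V|]%SET.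
  apply: inj_row_free => c c0; apply/rowP => l; rewrite mxE.
  apply: (uT (fun l => c 0 l)) => i _.
  have /rowP/(_ (enum_rank_in (finset.in_setT i) i)) := c0.
  rewrite !mxE => ci; rewrite -[RHS]ci; apply: eq_bigr => l' _.
  by rewrite !mxE enum_rankK_in ?inE.
have V_gt0 : (0 < #|V|)%N.
  have [I [_ Ik _]] := unisolvent_subset uT.
  by rewrite -(card_ord #|V|) (leq_trans k_gt0)// -Ik max_card.
have [P [[/and3P[_ Ptriv _] Pfree Pcard] t_gt0]] := delta_partition V_gt0 fT.
set t := delta phi in Pcard t_gt0 *.
(* Blocks are used cyclically; the default [set0] is never reached since [j %% t] is below the
   number of blocks. *)
pose B (j : 'I_m) := nth finset.set0 (enum P) (j %% t).
have lt_P (j : 'I_m) : (j %% t < size (enum P))%N.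
  by rewrite -cardE Pcard ltn_pmod.
have BP j : B j \in P by rewrite -mem_enum mem_nth.
have [J JP] : {J : 'I_m -> {set 'I_#|V|} & forall j,
    [/\ J j \subset B j, #|J j| = k & unisolvent phi (J j)]}.
  apply: (@choice _ _ (fun j (I : {set 'I_#|V|}) =>
    [/\ I \subset B j, #|I| = k & unisolvent phi I])) => j.
  by apply/unisolvent_subset/unisolvent_restricted_free/Pfree.
exists (sampling_set x (fun j => rk @^-1: J j)%SET); split.
- by move=> p /in_sampling_set[j _ ->]; exact: xO.
- apply: (determines_sampling_set rk_bij Gfree FE) => j.
  by have [] := JP j.
- move=> v; rewrite nb_samples_sampling_set//.
  (* This is the bound of (c) with the denominator cleared. *)
  suff nt : (t * #|[set j | v \in (rk @^-1: J j)%SET]%SET| < m + t)%N.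
    have t0 : 0 < t%:R :> rat by rewrite ltr0n.
    rewrite -(ltr_pM2r t0) mulrDl mulfVK ?gt_eqF// mul1r -natrM -natrD ltr_nat.
    by rewrite mulnC.
  have [->|/finset.set0Pn[j0]] :=
      eqVneq [set j | v \in (rk @^-1: J j)%SET]%SET finset.set0.
    by rewrite cards0 muln0 addn_gt0 m_gt0.
  rewrite !inE => vj0.
  (* Blocks are disjoint, so the block containing [rk v] is the same for every [j] that uses [v]. *)
  have vB j : rk v \in J j -> finset.pblock P (rk v) = B j.
    move=> vJ; apply: finset.def_pblock => //.
    by have [/fintype.subsetP sJB _ _] := JP j; exact: sJB.
  apply: leq_ltn_trans (card_residue_class (j0 %% t)%N m_gt0 t_gt0).
  rewrite leq_mul2l subset_leq_card ?orbT//.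
  apply/fintype.subsetP => j; rewrite !inE => vj.
  (* Distinct positions in [enum P] carry distinct blocks, so equal blocks force [j] and [j0] to be
     congruent modulo [t]. *)
  have := nth_uniq finset.set0 (lt_P j) (lt_P j0) (enum_uniq _).
  by rewrite -/(B j) -/(B j0) -(vB _ vj) -(vB _ vj0) eqxx => <-.
rewrite sum_nb_samples_sampling_set//.
under eq_bigr => j _ do (rewrite card_rk; have [_ -> _] := JP j).
by rewrite sum_nat_const card_ord mulnC.
Qed.
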